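(* Let $|q|<1$. For every complex $z$, \[ \sum_{n=0}^{\infty}\frac{z^nq^{n^2}}{(-q;q)_n}=\frac{1}{(-q;q)_{\infty}}\sum_{n=0}^{\infty}q^{n(n+1)/2}\sum_{i=0}^{n}\frac{z^iq^{i(i-1)/2}}{(q;q)_{n-i}}, \] and for every complex $z\neq0$, \[ \sum_{n=0}^{\infty}\frac{z^nq^{n^2}}{(-q;q)_n}=\frac{(-z^{-1}q;q)_{\infty}}{(-q;q)_{\infty}}\sum_{n=0}^{\infty}(-z;q)_nq^{n(n+1)/2}-\frac{1}{(-q;q)_{\infty}}\sum_{n=0}^{\infty}q^{n(n+1)/2}\sum_{i=1}^{\infty}\frac{z^{-i}q^{i(i+1)/2}}{(q;q)_{n+i}}. \]
   Context: Notation: $(a;q)_0=1$, $(a;q)_n=\prod_{k=0}^{n-1}(1-aq^k)$, $(a;q)_\infty=\prod_{k=0}^{\infty}(1-aq^k)$. *)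

(* Defs.v *)
From Stdlib Require Import Reals.
From Coquelicot Require Import Coquelicot.
Open Scope C_scope.

(* [Series] and [Lim_seq] are real-valued in Coquelicot.  The complex versions
   below are built from [iota], as [RInt] is: their value is meaningful only
   when the corresponding [ex_series] or [ex_qpoch_inf] holds. *)
Definition CSeries (a : nat -> C) : C :=
  iota (T := CompleteNormedModule.CompleteSpace _ C_CompleteNormedModule) (is_series a).

Fixpoint qpoch (a q : C) (n : nat) : C :=
  match n with
  | O => 1
  | S m => qpoch a q m * (1 - a * q ^ m)
  end.

Definition is_qpoch_inf (a q l : C) : Prop :=
  filterlim (qpoch a q) eventually (locally l).

Definition ex_qpoch_inf (a q : C) : Prop := exists l : C, is_qpoch_inf a q l.

Definition qpoch_inf (a q : C) : C :=
  iota (T := CompleteNormedModule.CompleteSpace _ C_CompleteNormedModule) (is_qpoch_inf a q).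

Lemma CSeries_unique (a : nat -> C) (l : C) : is_series a l -> CSeries a = l.
Proof.
intros H; apply (iota_filterlim_locally (V := C_CompleteNormedModule)
  (F := eventually) (sum_n a)); exact H.
Qed.

Lemma qpoch_inf_unique (a q l : C) : is_qpoch_inf a q l -> qpoch_inf a q = l.
Proof.
intros H; apply (iota_filterlim_locally (V := C_CompleteNormedModule)
  (F := eventually) (qpoch a q)); exact H.
Qed.

(* Main.v *)
(** Euler's sum [E(x) = sum_k q^(k(k-1)/2) x^k / (q;q)_k] satisfies
    [E(x) = (1 + x) E(qx)], hence [E(x) = (-x;q)_n E(q^n x)]; as [E] tends to 1
    at 0, the product [(-x;q)_inf] converges to [E(x)], and [(-q;q)_inf] is not 0.

    Multiplying the left-hand series by [(-q;q)_inf] and expanding each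
    [(-q;q)_inf / (-q;q)_n = E(q^(n+1))] gives an absolutely convergent double
    series, whose summation along the diagonals is the first identity.  For the
    second, the inner sums over [i >= 0] and over [i >= 1] are the two halves of
    a bilateral series with sum [(-z;q)_n (-q/z;q)_inf].

    The crude bound [|1/(q;q)_k| <= (1-|q|)^(-k)] suffices for all estimates,
    because it is absorbed by the Gaussian factor [q^(k(k-1)/2)]. *)
Require Import Defs.
From Stdlib Require Import Reals Lra Lia.
From Coquelicot Require Import Coquelicot.
Open Scope C_scope.

(** * Arithmetic of the triangular exponents *)

Lemma half_pred_S (n : nat) :
  (S n * (S n - 1) / 2 = n * (n - 1) / 2 + n)%nat.
Proof.
replace (S n * (S n - 1))%nat with (n * (n - 1) + n * 2)%nat
  by (destruct n; simpl; nia).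
apply Nat.div_add; lia.
Qed.

Lemma half_succ (n : nat) : (n * (n + 1) / 2 = n * (n - 1) / 2 + n)%nat.
Proof.
replace (n * (n + 1))%nat with (n * (n - 1) + n * 2)%nat
  by (destruct n; simpl; nia).
apply Nat.div_add; lia.
Qed.

Lemma half_pred_add (i k : nat) :
  ((i + k) * (i + k - 1) / 2 = i * (i - 1) / 2 + k * (k - 1) / 2 + i * k)%nat.
Proof.
induction i as [|i IH].
- simpl; lia.
- change (S i + k)%nat with (S (i + k)).
  rewrite !half_pred_S, IH; nia.
Qed.

(** In the estimates, one triangular part of the exponent [n ^ 2] supplies the Gaussian decay and
    the other is bounded by 1. *)
Lemma half_pred_square (n : nat) :
  (n ^ 2 = n * (n - 1) / 2 + (n * (n - 1) / 2 + n))%nat.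
Proof.
induction n as [|n IH]; [reflexivity|].
rewrite half_pred_S; simpl in *; nia.
Qed.

(** * Gaussian majorants *)

Lemma pow_le_1 (r : R) (n : nat) : (0 <= r <= 1 -> r ^ n <= 1)%R.
Proof. intros H; rewrite <- (pow1 n); apply pow_incr; exact H. Qed.

Lemma ex_series_gauss (r c : R) : (0 <= r < 1)%R -> (0 <= c)%R ->
  ex_series (fun k : nat => (r ^ (k * (k - 1) / 2) * c ^ k)%R).
Proof.
intros Hr Hc.
(* The ratio test needs nonzero terms, but [r] and [c] may vanish. The comparison series uses [s],
   with [r < s < 1], and [c + 1]; its ratio [s ^ n * (c + 1)] tends to 0. *)
set (s := ((1 + r) / 2)%R).
assert (Hs : (0 < s < 1)%R) by (unfold s; lra).
apply (ex_series_le (V := R_CompleteNormedModule) _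
  (fun k => Rabs (s ^ (k * (k - 1) / 2) * (c + 1) ^ k))).
- intros k.
  change norm with Rabs.
  rewrite !Rabs_mult, <- !RPow_abs.
  apply Rmult_le_compat; try (apply pow_le, Rabs_pos);
    apply pow_incr; split; try apply Rabs_pos;
    rewrite !Rabs_pos_eq; unfold s; lra.
- apply ex_series_DAlembert with 0%R; [lra| |].
  + intros n; apply Rmult_integral_contrapositive; split; apply pow_nonzero; lra.
  + apply is_lim_seq_ext with (fun n => (s ^ n * (c + 1))%R).
    * intros n; rewrite half_pred_S, pow_add; simpl pow.
      rewrite Rabs_pos_eq.
      -- field; split; apply pow_nonzero; lra.
      -- apply Rdiv_le_0_compat;
           repeat apply Rmult_le_pos; repeat apply Rmult_lt_0_compat;
           try apply pow_lt; try apply pow_le; lra.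
    * replace (Finite 0) with (Rbar_mult 0 (c + 1)%R)
        by (simpl; f_equal; ring).
      apply is_lim_seq_scal_r, is_lim_seq_geom.
      rewrite Rabs_pos_eq; lra.
Qed.

(** * Dominated series and summation along diagonals *)

Lemma is_series_norm_le {K : AbsRing} {V : NormedModule K}
  (a : nat -> V) (b : nat -> R) (l : V) (B : R) :
  (forall n, norm (a n) <= b n)%R -> is_series a l -> is_series b B ->
  (norm l <= B)%R.
Proof.
intros Hab Ha Hb.
apply (filterlim_le (F := eventually)
  (fun n => norm (sum_n a n)) (sum_n b) (norm l) B).
- exists 0%nat; intros n _.
  apply Rle_trans with (1 := norm_sum_n_m a 0 n).
  apply sum_n_m_le; exact Hab.
- exact (filterlim_comp _ _ _ _ _ _ _ _ Ha (filterlim_norm l)).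
- exact Hb.
Qed.

(** The tails after index [m] are themselves series, with sums [l - sum_n a m] and [B - sum_n b m],
    so the domination bound applies to them. *)
Lemma is_series_tail_norm_le {K : AbsRing} {V : NormedModule K}
  (a : nat -> V) (b : nat -> R) (l : V) (B : R) (m : nat) :
  (forall n, norm (a n) <= b n)%R -> is_series a l -> is_series b B ->
  (norm (minus (sum_n a m) l) <= B - sum_n b m)%R.
Proof.
intros Hab Ha Hb.
rewrite <- norm_opp, opp_minus.
apply (is_series_norm_le (fun k => a (S m + k)%nat) (fun k => b (S m + k)%nat)).
- intros n; apply Hab.
- apply is_series_incr_n; [lia|].
  refine (eq_ind_r (fun x => is_series a x) Ha _).
  unfold minus; rewrite <- plus_assoc.
  etransitivity; [apply f_equal, (plus_opp_l (G := V))|apply plus_zero_r].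
- apply is_series_incr_n; [lia|].
  refine (eq_ind_r (fun x => is_series b x) Hb _).
  change (B - sum_n b m + sum_n b m = B)%R; ring.
Qed.

(** Used twice: to compare triangular partial sums with partial sums of the row sums, and finite
    products with their constant candidate limit. *)
Lemma filterlim_close_norm {K : AbsRing} {V : NormedModule K}
  (u w : nat -> V) (l : V) (e : nat -> R) :
  eventually (fun n => norm (minus (u n) (w n)) <= e n)%R -> is_lim_seq e 0 ->
  filterlim w eventually (locally l) -> filterlim u eventually (locally l).
Proof.
intros Hu He Hw.
apply filterlim_locally_ball_norm; intros eps.
apply is_lim_seq_spec in He.
destruct (He (pos_div_2 eps)) as [N1 H1]; destruct Hu as [N2 H2].
destruct (proj1 (filterlim_locally_ball_norm w l) Hw (pos_div_2 eps))
  as [N3 H3].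
exists (max N1 (max N2 N3)); intros n Hn.
specialize (H1 n ltac:(lia)); specialize (H2 n ltac:(lia)).
specialize (H3 n ltac:(lia)).
replace (pos eps) with (pos (pos_div_2 eps) + pos (pos_div_2 eps))%R
  by (simpl; field).
apply ball_norm_triangle with (w n); [exact H3|].
unfold ball_norm.
apply Rle_lt_trans with (1 := H2).
apply Rle_lt_trans with (1 := Rle_abs _).
rewrite Rminus_0_r in H1; exact H1.
Qed.

Lemma minus_sum_n {G : AbelianGroup} (f g : nat -> G) (N : nat) :
  minus (sum_n f N) (sum_n g N) = sum_n (fun i => minus (f i) (g i)) N.
Proof.
induction N as [|N IH]; [now rewrite !sum_O|].
rewrite !sum_Sn, <- IH; unfold minus; rewrite opp_plus, <- !plus_assoc.
f_equal; rewrite !plus_assoc; f_equal; apply plus_comm.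
Qed.

(** The triangle [i + k <= N] is listed by antidiagonals and by rows. Passing to [S N] adds one
    entry to each row and opens one new row, which together form the new antidiagonal. *)
Lemma sum_n_diag {G : AbelianMonoid} (a : nat -> nat -> G) (N : nat) :
  sum_n (fun m => sum_n (fun i => a i (m - i)%nat) m) N
  = sum_n (fun i => sum_n (a i) (N - i)) N.
Proof.
induction N as [|N IH].
- now rewrite !sum_O.
- rewrite sum_Sn, IH, !(sum_Sn _ N), Nat.sub_diag, sum_O.
  rewrite plus_assoc, <- sum_n_plus.
  f_equal; apply sum_n_ext_loc; intros i Hi.
  replace (S N - i)%nat with (S (N - i)) by lia.
  now rewrite sum_Sn.
Qed.

Lemma sum_n_Rmult_l (c : R) (u : nat -> R) (n : nat) :
  sum_n (fun k => c * u k)%R n = (c * sum_n u n)%R.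
Proof. exact (sum_n_mult_l (K := R_Ring) c u n). Qed.

(* The error of the triangular partial sum is dominated by that of the real
   Cauchy product of [u] and [v]. *)
Lemma is_series_diag {K : AbsRing} {V : NormedModule K}
  (a : nat -> nat -> V) (s : nat -> V) (u v : nat -> R) (l : V) :
  (forall n k, norm (a n k) <= u n * v k)%R ->
  (forall n, 0 <= u n)%R -> (forall n, 0 <= v n)%R ->
  ex_series u -> ex_series v ->
  (forall n, is_series (a n) (s n)) -> is_series s l ->
  is_series (fun m => sum_n (fun i => a i (m - i)%nat) m) l.
Proof.
intros Ha Hu0 Hv0 [U HU] [W HW] Hs Hl.
apply filterlim_close_norm with (sum_n s)
  (fun N => sum_n (fun i => u i * (W - sum_n v (N - i)))%R N).
- exists 0%nat; intros N _.
  rewrite sum_n_diag.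
  rewrite (minus_sum_n (G := V)).
  apply Rle_trans with (1 := norm_sum_n_m _ 0 N).
  apply sum_n_m_le; intros i.
  (* Row [i] is cut at [N - i]; its missing tail is dominated by that of [u i * v k]. *)
  replace (u i * (W - sum_n v (N - i)))%R
    with (u i * W - sum_n (fun k => u i * v k) (N - i))%R.
  + apply is_series_tail_norm_le; [apply Ha|apply Hs|].
    exact (is_series_scal (V := R_NormedModule) (u i) v W HW).
  + rewrite sum_n_Rmult_l.
    ring.
(* The total error bound is [sum_n u N * W] minus the triangular sum of [u i * v k]. Both tend to
   [U * W], the latter by the Cauchy product of nonnegative series. *)
- apply is_lim_seq_ext with
    (fun N => sum_n u N * W
      - sum_n (fun m => sum_f_R0 (fun i => u i * v (m - i)%nat) m) N)%R.
  + intros M.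
    rewrite (sum_n_ext (fun m => sum_f_R0 _ m)
      (fun m => sum_n (fun i => u i * v (m - i)%nat)%R m))
      by (intros m; now rewrite sum_n_Reals).
    rewrite (sum_n_diag (G := R_AbelianMonoid) (fun i k => u i * v k)%R).
    rewrite (sum_n_ext (fun i => sum_n (fun k => u i * v k) (M - i))%R
      (fun i => u i * sum_n v (M - i))%R)
      by (intros i; apply sum_n_Rmult_l).
    rewrite Rmult_comm.
    rewrite <- sum_n_Rmult_l.
    etransitivity; [apply (minus_sum_n (G := R_AbelianGroup))|].
    apply sum_n_ext; intros i.
    change (W * u i - u i * sum_n v (M - i) = u i * (W - sum_n v (M - i)))%R.
    ring.
  + replace (Finite 0) with (Finite (U * W - U * W)) by (f_equal; ring).
    apply is_lim_seq_minus'.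
    * apply (is_lim_seq_scal_r (sum_n u) W U); exact HU.
    * exact (is_series_mult_pos u v U W HU HW Hu0 Hv0).
- exact Hl.
Qed.

(** * Complex series and bounds on finite q-products *)

Lemma CSeries_correct (a : nat -> C) : ex_series a -> is_series a (CSeries a).
Proof. intros [l Hl]; now rewrite (CSeries_unique a l Hl). Qed.

Lemma ex_series_Cmod_le (a : nat -> C) (b : nat -> R) :
  (forall n, Cmod (a n) <= b n)%R -> ex_series b -> ex_series a.
Proof. exact (ex_series_le (V := C_CompleteNormedModule) a b). Qed.

Lemma qpoch_factor_ge (a q : C) (n : nat) : (Cmod q <= 1)%R ->
  (1 - Cmod a <= Cmod (1 - a * q ^ n))%R.
Proof.
intros Hq.
assert (H := Cmod_triangle (1 - a * q ^ n) (a * q ^ n)).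
replace (1 - a * q ^ n + a * q ^ n) with (RtoC 1) in H by ring.
rewrite Cmod_1, Cmod_mult, Cmod_pow in H.
assert (H1 := pow_le_1 (Cmod q) n (conj (Cmod_ge_0 q) Hq)).
assert (H2 := Cmod_ge_0 a).
nra.
Qed.

Lemma qpoch_neq_0 (a q : C) (n : nat) : (Cmod a < 1)%R -> (Cmod q <= 1)%R ->
  qpoch a q n <> 0.
Proof.
intros Ha Hq; induction n as [|n IH]; simpl.
- apply C1_nz.
- apply Cmult_neq_0; [exact IH|].
  apply Cmod_gt_0; assert (H := qpoch_factor_ge a q n Hq); lra.
Qed.

Lemma Cmod_inv_qpoch_le (a q : C) (n : nat) :
  (Cmod a < 1)%R -> (Cmod q <= 1)%R ->
  (Cmod (/ qpoch a q n) <= (/ (1 - Cmod a)) ^ n)%R.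
Proof.
intros Ha Hq; rewrite Cmod_inv by (apply qpoch_neq_0; assumption).
rewrite pow_inv; apply Rinv_le_contravar; [apply pow_lt; lra|].
induction n as [|n IH]; simpl.
- rewrite Cmod_1; lra.
- rewrite Cmod_mult, Rmult_comm.
  apply Rmult_le_compat; try apply pow_le; try lra.
  apply qpoch_factor_ge; exact Hq.
Qed.

Lemma Cmod_qpoch_le (a q : C) (n : nat) : (Cmod q <= 1)%R ->
  (Cmod (qpoch a q n) <= (1 + Cmod a) ^ n)%R.
Proof.
intros Hq; induction n as [|n IH]; simpl.
- rewrite Cmod_1; lra.
- rewrite Cmod_mult, Rmult_comm.
  apply Rmult_le_compat; try apply Cmod_ge_0; [|exact IH].
  apply Rle_trans with (1 := Cmod_triangle _ _).
  rewrite Cmod_1, Cmod_opp, Cmod_mult, Cmod_pow.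
  assert (H1 := pow_le_1 (Cmod q) n (conj (Cmod_ge_0 q) Hq)).
  assert (H2 := Cmod_ge_0 a).
  nra.
Qed.

(** * Euler's sum and the infinite product *)

Definition euler_term (q x : C) (k : nat) : C :=
  q ^ (k * (k - 1) / 2) * x ^ k / qpoch q q k.

Definition euler_sum (q x : C) : C := CSeries (euler_term q x).

Section Euler.

Context (q : C) (hq : (Cmod q < 1)%R).

Lemma qpoch_q_neq_0 (n : nat) : qpoch q q n <> 0.
Proof. apply qpoch_neq_0; [exact hq|apply Rlt_le, hq]. Qed.

Lemma inv_one_sub_Cmod_pos : (0 < / (1 - Cmod q))%R.
Proof. apply Rinv_0_lt_compat; lra. Qed.

Lemma Cmod_euler_term_le (x : C) (k : nat) :
  (Cmod (euler_term q x k)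
   <= Cmod q ^ (k * (k - 1) / 2) * (Cmod x * / (1 - Cmod q)) ^ k)%R.
Proof.
unfold euler_term, Cdiv.
rewrite !Cmod_mult, !Cmod_pow, Rpow_mult_distr, <- Rmult_assoc.
apply Rmult_le_compat_l.
- apply Rmult_le_pos; apply pow_le, Cmod_ge_0.
- apply Cmod_inv_qpoch_le; lra.
Qed.

Lemma ex_series_gauss_Cmod (d : R) : (0 <= d)%R ->
  ex_series (fun k : nat => (Cmod q ^ (k * (k - 1) / 2) * d ^ k)%R).
Proof. apply ex_series_gauss; split; [apply Cmod_ge_0|exact hq]. Qed.

Lemma is_series_euler (x : C) : is_series (euler_term q x) (euler_sum q x).
Proof.
apply CSeries_correct.
apply (ex_series_Cmod_le _ _ (Cmod_euler_term_le x)).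
apply ex_series_gauss_Cmod, Rmult_le_pos; [apply Cmod_ge_0|].
apply Rlt_le, inv_one_sub_Cmod_pos.
Qed.

(** Replacing x by qx multiplies term k by q^k. In the difference E(x) - E(qx) the factor 1 - q^k
    cancels the last factor of (q;q)_k and kills the constant term; shifting the index leaves x
    E(qx). *)
Lemma euler_sum_shift (x : C) :
  euler_sum q x = (1 + x) * euler_sum q (q * x).
Proof.
assert (H : is_series
  (fun k => plus (euler_term q x k) (opp (euler_term q (q * x) k)))
  (euler_sum q x - euler_sum q (q * x))).
{ apply (is_series_minus (V := C_NormedModule)); apply is_series_euler. }
assert (H' : is_series
  (fun k => plus (euler_term q x k) (opp (euler_term q (q * x) k)))
  (x * euler_sum q (q * x))).
{ apply is_series_decr_1.
  apply (is_series_ext (fun k => x * euler_term q (q * x) k)).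
  - intros k.
    change (x * euler_term q (q * x) k
      = euler_term q x (S k) - euler_term q (q * x) (S k)).
    unfold euler_term.
    assert (H0 := qpoch_q_neq_0 (S k)).
    rewrite half_pred_S, Cpow_add_r, !Cpow_mult_l.
    simpl in *; field.
    split; contradict H0; rewrite H0; ring.
  - refine (eq_ind_r (fun s => is_series _ s)
      (is_series_scal (V := C_NormedModule) x _ _ (is_series_euler (q * x))) _).
    change (x * euler_sum q (q * x)
      - (euler_term q x 0 - euler_term q (q * x) 0)
      = x * euler_sum q (q * x)).
    unfold euler_term; simpl; field; apply C1_nz. }
apply CSeries_unique in H; apply CSeries_unique in H'.
rewrite H in H'.
replace (euler_sum q x)
  with (euler_sum q x - euler_sum q (q * x) + euler_sum q (q * x)) by ring.
rewrite H'; ring.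
Qed.

Lemma euler_sum_qpoch (x : C) (n : nat) :
  euler_sum q x = qpoch (- x) q n * euler_sum q (q ^ n * x).
Proof.
induction n as [|n IH]; simpl.
- now rewrite !Cmult_1_l.
- rewrite IH at 1; rewrite (euler_sum_shift (q ^ n * x)).
  replace (q * q ^ n * x) with (q * (q ^ n * x)) by ring; ring.
Qed.

(** Each term with k >= 1 is at most |y| times its majorant at |y| = 1, since |y|^k <= |y|; these
    majorants add up to [B - 1]. Having [1 <= K] makes smallness of K|y| imply |y| <= 1 later. *)
Lemma euler_sum_near_0 : exists K : R, (1 <= K)%R /\
  forall y : C, (Cmod y <= 1)%R -> (Cmod (euler_sum q y - 1) <= K * Cmod y)%R.
Proof.
destruct (ex_series_gauss_Cmod (/ (1 - Cmod q))) as [B HB].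
{ apply Rlt_le, inv_one_sub_Cmod_pos. }
exists (Rmax 1 (B - 1)); split; [apply Rmax_l|]; intros y Hy.
apply Rle_trans with ((B - 1) * Cmod y)%R;
  [|apply Rmult_le_compat_r; [apply Cmod_ge_0|apply Rmax_r]].
apply (is_series_norm_le (V := C_NormedModule) (fun k => euler_term q y (S k))
  (fun k => (Cmod q ^ (S k * (S k - 1) / 2) * (/ (1 - Cmod q)) ^ S k)
     * Cmod y)%R).
- intros k; change norm with Cmod.
  apply Rle_trans with (1 := Cmod_euler_term_le y (S k)).
  rewrite Rpow_mult_distr.
  rewrite (Rmult_comm (Cmod y ^ S k)), <- Rmult_assoc.
  assert (Hp := inv_one_sub_Cmod_pos).
  apply Rmult_le_compat_l.
  + apply Rmult_le_pos; apply pow_le; [apply Cmod_ge_0|lra].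
  + simpl; assert (H := pow_le_1 (Cmod y) k (conj (Cmod_ge_0 y) Hy)).
    assert (H0 := Cmod_ge_0 y); nra.
- apply (is_series_incr_1 (euler_term q y)).
  refine (eq_ind_r (fun s => is_series _ s) (is_series_euler y) _).
  change (euler_sum q y - 1 + euler_term q y 0 = euler_sum q y).
  unfold euler_term; simpl; field; apply C1_nz.
- apply is_series_scal_r.
  apply (is_series_incr_1
    (fun k => Cmod q ^ (k * (k - 1) / 2) * (/ (1 - Cmod q)) ^ k)%R).
  refine (eq_ind_r (fun s => is_series _ s) HB _).
  change (B - 1 + 1 * 1 = B)%R; ring.
Qed.

Lemma euler_sum_tail_near_1 (x : C) : exists e : nat -> R,
  is_lim_seq e 0 /\
  eventually (fun n => Cmod (euler_sum q (q ^ n * x) - 1) <= e n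
    /\ 1 / 2 <= Cmod (euler_sum q (q ^ n * x)))%R.
Proof.
destruct euler_sum_near_0 as [K [HK H]].
exists (fun n => K * Cmod x * Cmod q ^ n)%R.
assert (He : is_lim_seq (fun n => K * Cmod x * Cmod q ^ n)%R 0).
{ replace (Finite 0) with (Rbar_mult (K * Cmod x)%R 0)
    by (simpl; f_equal; ring).
  apply is_lim_seq_scal_l, is_lim_seq_geom.
  rewrite Rabs_pos_eq; [exact hq|apply Cmod_ge_0]. }
split; [exact He|].
apply is_lim_seq_spec in He.
(* The threshold 1/2 serves twice: as K >= 1 it forces |q^n x| <= 1, and it keeps E(q^n x) at
   distance at least 1/2 from 0. *)
destruct (He (mkposreal (1 / 2) ltac:(lra))) as [N HN].
exists N; intros n Hn.
specialize (HN n Hn); simpl in HN; rewrite Rminus_0_r in HN.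
apply Rle_lt_trans with (1 := Rle_abs _) in HN.
assert (Hy : Cmod (q ^ n * x) = (Cmod q ^ n * Cmod x)%R)
  by now rewrite Cmod_mult, Cmod_pow.
assert (H0 : (0 <= Cmod q ^ n * Cmod x)%R) by (rewrite <- Hy; apply Cmod_ge_0).
assert (H1 : (Cmod (euler_sum q (q ^ n * x) - 1) <= K * Cmod x * Cmod q ^ n)%R).
{ replace (K * Cmod x * Cmod q ^ n)%R with (K * Cmod (q ^ n * x))%R
    by (rewrite Hy; ring).
  apply H; rewrite Hy; nra. }
split; [exact H1|].
assert (H2 := Cmod_triangle (euler_sum q (q ^ n * x))
  (- (euler_sum q (q ^ n * x) - 1))).
replace (euler_sum q (q ^ n * x) + - (euler_sum q (q ^ n * x) - 1))
  with (RtoC 1) in H2 by ring.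
rewrite Cmod_opp, Cmod_1 in H2; lra.
Qed.

(** Write E(x) = p y with p the finite product and y = E(q^n x). The error is p(1 - y), and |y| >=
    1/2 gives |p| <= 2|E(x)|. No division by E(x) occurs, so products with a zero factor are
    covered. *)
Lemma is_qpoch_inf_euler (x : C) : is_qpoch_inf (- x) q (euler_sum q x).
Proof.
destruct (euler_sum_tail_near_1 x) as [e [He [N HN]]].
apply (filterlim_close_norm (V := C_NormedModule) _ (fun _ => euler_sum q x) _
  (fun n => 2 * Cmod (euler_sum q x) * e n)%R).
- exists N; intros n Hn.
  destruct (HN n Hn) as [H1 H2].
  change (Cmod (qpoch (- x) q n - euler_sum q x)
    <= 2 * Cmod (euler_sum q x) * e n)%R.
  rewrite (euler_sum_qpoch x n).
  set (p := qpoch (- x) q n) in *; set (y := euler_sum q (q ^ n * x)) in *.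
  replace (p - p * y) with (p * - (y - 1)) by ring.
  rewrite !Cmod_mult, Cmod_opp.
  assert (Hp := Cmod_ge_0 p); assert (H3 := Cmod_ge_0 (y - 1)).
  apply Rle_trans with (Cmod p * e n)%R; [nra|].
  apply Rmult_le_compat_r; nra.
- replace (Finite 0) with (Rbar_mult (2 * Cmod (euler_sum q x))%R 0)
    by (simpl; f_equal; ring).
  apply is_lim_seq_scal_l; exact He.
- apply filterlim_const.
Qed.

Lemma euler_sum_neq_0 (x : C) : (Cmod x < 1)%R -> euler_sum q x <> 0.
Proof.
intros Hx.
destruct (euler_sum_tail_near_1 x) as [e [_ [N HN]]].
destruct (HN N (le_n N)) as [_ H].
rewrite (euler_sum_qpoch x N).
apply Cmult_neq_0.
- apply qpoch_neq_0; [rewrite Cmod_opp; exact Hx|lra].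
- apply Cmod_gt_0; lra.
Qed.

(** * The first identity by diagonal summation *)

Lemma ex_series_base (z : C) :
  ex_series (fun n : nat => z ^ n * q ^ (n ^ 2) / qpoch (- q) q n).
Proof.
apply (ex_series_Cmod_le _ (fun n => Cmod q ^ (n * (n - 1) / 2)
  * (Cmod z * / (1 - Cmod q)) ^ n)%R).
- intros n; unfold Cdiv.
  rewrite !Cmod_mult, !Cmod_pow, half_pred_square, pow_add, Rpow_mult_distr.
  assert (H1 := Cmod_inv_qpoch_le (- q) q n).
  rewrite Cmod_opp in H1; specialize (H1 hq (Rlt_le _ _ hq)).
  assert (H2 := pow_le_1 (Cmod q) (n * (n - 1) / 2 + n)
    (conj (Cmod_ge_0 q) (Rlt_le _ _ hq))).
  assert (H3 : (0 <= Cmod q ^ (n * (n - 1) / 2))%R)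
    by apply pow_le, Cmod_ge_0.
  assert (H4 : (0 <= Cmod z ^ n)%R) by apply pow_le, Cmod_ge_0.
  rewrite <- (Rmult_assoc _ (Cmod z ^ n)).
  apply Rmult_le_compat; [|apply Cmod_ge_0| |exact H1].
  + repeat apply Rmult_le_pos; try exact H4; try apply pow_le, Cmod_ge_0; exact H3.
  + rewrite (Rmult_comm (Cmod q ^ _) (Cmod z ^ n)).
    apply Rmult_le_compat_l; [exact H4|]; nra.
- apply ex_series_gauss_Cmod, Rmult_le_pos; [apply Cmod_ge_0|].
  apply Rlt_le, inv_one_sub_Cmod_pos.
Qed.

Definition inner_sum (z : C) (n : nat) : C :=
  sum_n (fun i : nat => z ^ i * q ^ (i * (i - 1) / 2) / qpoch q q (n - i)) n.

(* Both sides are the sum over [n, k] of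
   [z^n q^(n^2) q^(k(k-1)/2) (q^(n+1))^k / (q;q)_k]: over [k] first this is
   Euler's expansion of [(-q;q)_inf / (-q;q)_n], and [n + k = N] gives the
   right-hand side. *)
Lemma is_series_diagonal (z : C) :
  is_series (fun n : nat => q ^ (n * (n + 1) / 2) * inner_sum z n)
    (euler_sum q q
     * CSeries (fun n : nat => z ^ n * q ^ (n ^ 2) / qpoch (- q) q n)).
Proof.
assert (Hinv := inv_one_sub_Cmod_pos).
apply (is_series_ext (fun N => sum_n
  (fun i => z ^ i * q ^ (i ^ 2) * euler_term q (q ^ i * q) (N - i)) N)).
{ intros N; unfold inner_sum.
  rewrite <- (sum_n_mult_l (K := C_Ring)).
  apply sum_n_ext_loc; intros i Hi.
  change (z ^ i * q ^ (i ^ 2) * euler_term q (q ^ i * q) (N - i)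
    = q ^ (N * (N + 1) / 2)
      * (z ^ i * q ^ (i * (i - 1) / 2) / qpoch q q (N - i))).
  unfold euler_term.
  (* With N = i + k the truncated subtraction disappears and both exponents of q expand to the same
     sum. *)
  assert (HN : N = (i + (N - i))%nat) by lia.
  generalize dependent (N - i)%nat; intros k ->.
  rewrite half_succ, half_pred_add, half_pred_square.
  rewrite Cpow_mult_l, <- (Cpow_mult_r q i k), !Cpow_add_r.
  field; apply qpoch_q_neq_0. }
apply (is_series_diag
  (fun n k => z ^ n * q ^ (n ^ 2) * euler_term q (q ^ n * q) k)
  (fun n => z ^ n * q ^ (n ^ 2) * euler_sum q (q ^ n * q))
  (fun n => Cmod q ^ (n * (n - 1) / 2) * Cmod z ^ n)%R
  (fun k => Cmod q ^ (k * (k - 1) / 2) * (/ (1 - Cmod q)) ^ k)%R).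
- intros n k.
  change norm with Cmod.
  rewrite !Cmod_mult, !Cmod_pow.
  apply Rmult_le_compat; try apply Cmod_ge_0.
  + apply Rmult_le_pos; apply pow_le, Cmod_ge_0.
  + rewrite half_pred_square, pow_add.
    assert (H2 := pow_le_1 (Cmod q) (n * (n - 1) / 2 + n)
      (conj (Cmod_ge_0 q) (Rlt_le _ _ hq))).
    assert (H3 : (0 <= Cmod q ^ (n * (n - 1) / 2))%R)
      by apply pow_le, Cmod_ge_0.
    assert (H4 : (0 <= Cmod z ^ n)%R) by apply pow_le, Cmod_ge_0.
    rewrite (Rmult_comm (Cmod q ^ _) (Cmod z ^ n)).
    apply Rmult_le_compat_l; [exact H4|]; nra.
  + apply Rle_trans with (1 := Cmod_euler_term_le (q ^ n * q) k).
    apply Rmult_le_compat_l; [apply pow_le, Cmod_ge_0|].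
    (* Bounding |q^n q| by 1 makes the majorant independent of [n], as the product form [u n * v k]
       requires. *)
    apply pow_incr; split.
    * apply Rmult_le_pos; [apply Cmod_ge_0|lra].
    * rewrite <- (Rmult_1_l (/ _)) at 2.
      apply Rmult_le_compat_r; [lra|].
      rewrite Cmod_mult, Cmod_pow, Rmult_comm.
      apply (pow_le_1 (Cmod q) (S n)); split; [apply Cmod_ge_0|lra].
- intros n; apply Rmult_le_pos; apply pow_le, Cmod_ge_0.
- intros k; apply Rmult_le_pos; apply pow_le; [apply Cmod_ge_0|lra].
- apply ex_series_gauss_Cmod, Cmod_ge_0.
- apply ex_series_gauss_Cmod; lra.
- intros n.
  apply (is_series_scal (V := C_NormedModule)), is_series_euler.
- apply (is_series_ext (fun n =>
    euler_sum q q * (z ^ n * q ^ (n ^ 2) / qpoch (- q) q n))).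
  + intros n.
    rewrite (euler_sum_qpoch q n).
    change (qpoch (- q) q n * euler_sum q (q ^ n * q)
      * (z ^ n * q ^ (n ^ 2) / qpoch (- q) q n)
      = z ^ n * q ^ (n ^ 2) * euler_sum q (q ^ n * q)).
    field.
    apply qpoch_neq_0; [rewrite Cmod_opp|]; lra.
  + apply (is_series_scal (V := C_NormedModule)), CSeries_correct,
      ex_series_base.
Qed.

(** * The bilateral series for the second identity *)

Lemma sum_n_succ_l (f : nat -> C) (n : nat) :
  sum_n f (S n) = f 0%nat + sum_n (fun i => f (S i)) n.
Proof.
induction n as [|n IH].
- now rewrite sum_Sn, !sum_O.
- rewrite sum_Sn, IH, sum_Sn; exact (eq_sym (Cplus_assoc _ _ _)).
Qed.

(* Multiply the [j]-th term by [1 = (1 - q^(n+1-j)) + q^(n+1-j)]: the first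
   part lowers the index of [(q;q)], the second shifts [j]. *)
Lemma inner_sum_S (z : C) (n : nat) :
  inner_sum z (S n)
  = (1 + z * q ^ n) * inner_sum z n + q ^ S n / qpoch q q (S n).
Proof.
set (t := fun j => z ^ j * q ^ (j * (j - 1) / 2) / qpoch q q (S n - j)).
assert (H : inner_sum z (S n)
  = sum_n (fun j => t j * (1 - q ^ (S n - j))) (S n)
    + sum_n (fun j => t j * q ^ (S n - j)) (S n)).
{ unfold inner_sum; fold t.
  etransitivity; [|exact (sum_n_plus (G := C_AbelianMonoid) _ _ _)].
  apply sum_n_ext; intros j.
  change (t j = t j * (1 - q ^ (S n - j)) + t j * q ^ (S n - j)); ring. }
(* The first sum loses its top term, where 1 - q^0 = 0; the second gives up its bottom term, which
   is the inhomogeneous term q^(n+1) / (q;q)_(n+1). *)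
rewrite H, sum_Sn, sum_n_succ_l; clear H.
assert (H1 : sum_n (fun j => t j * (1 - q ^ (S n - j))) n = inner_sum z n).
{ apply sum_n_ext_loc; intros j Hj; unfold t.
  replace (S n - j)%nat with (S (n - j)) by lia.
  assert (H := qpoch_q_neq_0 (S (n - j))).
  simpl in *; field; split; contradict H; rewrite H; ring. }
assert (H2 : sum_n (fun i => t (S i) * q ^ (S n - S i)) n
  = z * q ^ n * inner_sum z n).
{ unfold inner_sum; rewrite <- (sum_n_mult_l (K := C_Ring)).
  apply sum_n_ext_loc; intros i Hi; unfold t.
  change (z ^ S i * q ^ (S i * (S i - 1) / 2) / qpoch q q (n - i) * q ^ (n - i)
    = z * q ^ n * (z ^ i * q ^ (i * (i - 1) / 2) / qpoch q q (n - i))).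
  assert (Hn : n = (i + (n - i))%nat) by lia.
  generalize dependent (n - i)%nat; intros k ->.
  rewrite half_pred_S, !Cpow_add_r; simpl Cpow.
  field; apply qpoch_q_neq_0. }
rewrite H1, H2, Nat.sub_diag, Nat.sub_0_r.
change (inner_sum z n + t (S n) * (1 - 1)
  + (t 0%nat * q ^ S n + z * q ^ n * inner_sum z n)
  = (1 + z * q ^ n) * inner_sum z n + q ^ S n / qpoch q q (S n)).
replace (t 0%nat) with (/ qpoch q q (S n)).
- field; apply qpoch_q_neq_0.
- unfold t; rewrite Nat.sub_0_r; simpl Cpow; unfold Cdiv; ring.
Qed.

(** This is the bilateral term at j = -(i+1): with j = -m, j(j-1)/2 becomes m(m+1)/2 and n - j
    becomes n + m. *)
Definition outer_term (z : C) (n i : nat) : C :=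
  (/ z) ^ S i * q ^ (S i * (S i + 1) / 2) / qpoch q q (n + S i).

(* The bilateral sum over [j <= n] of [z^j q^(j(j-1)/2) / (q;q)_(n-j)] equals
   [(-z;q)_n (-q/z;q)_inf]; [inner_sum] is its part [j >= 0]. *)
Lemma is_series_outer (z : C) (n : nat) : z <> 0 ->
  is_series (outer_term z n)
    (qpoch (- z) q n * euler_sum q (/ z * q) - inner_sum z n).
Proof.
intros Hz; induction n as [|n IH].
(* For n = 0 the outer terms are Euler's terms at q/z from index 1 on; the missing term at index 0
   is [inner_sum z 0], equal to 1. *)
- apply (is_series_ext (fun i => euler_term q (/ z * q) (S i))).
  + intros i; change (euler_term q (/ z * q) (S i) = outer_term z 0 i).
    unfold outer_term, euler_term.
    rewrite half_succ, Cpow_mult_l, Cpow_add_r, Nat.add_0_l.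
    unfold Cdiv; ring.
  + apply (is_series_incr_1 (euler_term q (/ z * q))).
    refine (eq_ind_r (fun s => is_series _ s)
      (is_series_euler (/ z * q)) _).
    change (1 * euler_sum q (/ z * q) - inner_sum z 0
      + euler_term q (/ z * q) 0 = euler_sum q (/ z * q)).
    unfold inner_sum, euler_term; rewrite sum_O; simpl; field.
- set (b := qpoch (- z) q n * euler_sum q (/ z * q) - inner_sum z n) in *.
  assert (Hs : is_series (fun i => outer_term z n (S i))
    (b - outer_term z n 0)).
  { apply (is_series_incr_1 (outer_term z n)).
    refine (eq_ind_r (fun s => is_series _ s) IH _).
    change (b - outer_term z n 0 + outer_term z n 0 = b); ring. }
  (* Outer terms satisfy T(n+1,i) = T(n,i) + z q^n T(n,i+1), by the same splitting of 1 as for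
     [inner_sum_S]. The term T(n,0) lost in the shift yields exactly the inhomogeneous term
     there. *)
  apply (is_series_scal (V := C_NormedModule) (z * q ^ n)) in Hs.
  assert (H := is_series_plus (V := C_NormedModule) _ _ _ _ IH Hs).
  refine (eq_ind_r (fun s => is_series _ s) (is_series_ext _ _ _ _ H) _).
  + intros i.
    change (outer_term z n i + z * q ^ n * outer_term z n (S i)
      = outer_term z (S n) i).
    unfold outer_term.
    replace (n + S (S i))%nat with (S (n + S i)) by lia.
    change (S n + S i)%nat with (S (n + S i)).
    rewrite (half_succ (S (S i))), (half_pred_S (S i)), <- (half_succ (S i)).
    assert (H0 := qpoch_q_neq_0 (S (n + S i))).
    assert (H1 := qpoch_q_neq_0 (n + S i)).
    rewrite !Cpow_add_r; simpl qpoch in *; rewrite !Cpow_add_r in *.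
    simpl Cpow in *.
    field; repeat split; try assumption; contradict H0; rewrite H0; ring.
  + change (qpoch (- z) q (S n) * euler_sum q (/ z * q) - inner_sum z (S n)
      = b + z * q ^ n * (b - outer_term z n 0)).
    rewrite inner_sum_S; unfold b, outer_term.
    replace (n + 1)%nat with (S n) by lia.
    assert (H0 := qpoch_q_neq_0 (S n)).
    simpl in *; field; repeat split; try assumption;
      contradict H0; rewrite H0; ring.
Qed.

Lemma ex_series_qpoch (z : C) :
  ex_series (fun n : nat => qpoch z q n * q ^ (n * (n + 1) / 2)).
Proof.
apply (ex_series_Cmod_le _ (fun n => Cmod q ^ (n * (n - 1) / 2)
  * (1 + Cmod z) ^ n)%R).
- intros n; rewrite Cmod_mult, Cmod_pow, half_succ, pow_add, Rmult_comm.
  apply Rmult_le_compat; try apply Cmod_ge_0.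
  + apply Rmult_le_pos; apply pow_le, Cmod_ge_0.
  + assert (H2 := pow_le_1 (Cmod q) n (conj (Cmod_ge_0 q) (Rlt_le _ _ hq))).
    assert (H3 : (0 <= Cmod q ^ (n * (n - 1) / 2))%R)
      by apply pow_le, Cmod_ge_0.
    nra.
  + apply Cmod_qpoch_le; lra.
- apply ex_series_gauss_Cmod; assert (H := Cmod_ge_0 z); lra.
Qed.

End Euler.

(** * Assembly of both identities, with all convergence claims *)

Theorem theorem2p3 (q : C) (hq : (Cmod q < 1)%R) :
  (ex_qpoch_inf (- q) q /\ qpoch_inf (- q) q <> 0)
  /\
  (forall z : C,
     ex_series (fun n : nat => z ^ n * q ^ (n ^ 2) / qpoch (- q) q n)
     /\ ex_series (fun n : nat =>
          q ^ (n * (n + 1) / 2)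
          * sum_n (fun i : nat => z ^ i * q ^ (i * (i - 1) / 2) / qpoch q q (n - i)) n)
     /\ CSeries (fun n : nat => z ^ n * q ^ (n ^ 2) / qpoch (- q) q n)
        = 1 / qpoch_inf (- q) q
          * CSeries (fun n : nat =>
              q ^ (n * (n + 1) / 2)
              * sum_n (fun i : nat => z ^ i * q ^ (i * (i - 1) / 2) / qpoch q q (n - i)) n))
  /\
  (forall z : C, z <> 0 ->
     ex_qpoch_inf (- / z * q) q
     /\ ex_series (fun n : nat => qpoch (- z) q n * q ^ (n * (n + 1) / 2))
     (* the sums over i >= 1 are indexed from 0, with i replaced by S i *)
     /\ (forall n : nat,
           ex_series (fun i : nat =>
             (/ z) ^ S i * q ^ (S i * (S i + 1) / 2) / qpoch q q (n + S i)))
     /\ ex_series (fun n : nat =>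
          q ^ (n * (n + 1) / 2)
          * CSeries (fun i : nat =>
              (/ z) ^ S i * q ^ (S i * (S i + 1) / 2) / qpoch q q (n + S i)))
     /\ CSeries (fun n : nat => z ^ n * q ^ (n ^ 2) / qpoch (- q) q n)
        = qpoch_inf (- / z * q) q / qpoch_inf (- q) q
          * CSeries (fun n : nat => qpoch (- z) q n * q ^ (n * (n + 1) / 2))
          - 1 / qpoch_inf (- q) q
          * CSeries (fun n : nat =>
              q ^ (n * (n + 1) / 2)
              * CSeries (fun i : nat =>
                  (/ z) ^ S i * q ^ (S i * (S i + 1) / 2) / qpoch q q (n + S i)))).
Proof.
assert (HP : qpoch_inf (- q) q = euler_sum q q)
  by apply qpoch_inf_unique, is_qpoch_inf_euler, hq.
assert (HP0 : euler_sum q q <> 0) by (apply euler_sum_neq_0; exact hq).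
assert (HA := is_series_diagonal q hq).
split; [split|split].
- exists (euler_sum q q); apply is_qpoch_inf_euler, hq.
- rewrite HP; exact HP0.
- intros z; split; [|split].
  + apply ex_series_base, hq.
  + eexists; exact (HA z).
  + rewrite HP; unfold inner_sum in HA.
    rewrite (CSeries_unique _ _ (HA z)); field; exact HP0.
- intros z Hz.
  assert (Hx : - / z * q = - (/ z * q)) by ring.
  assert (HQ := is_qpoch_inf_euler q hq (/ z * q)).
  rewrite <- Hx in HQ.
  assert (HF := CSeries_correct _ (ex_series_qpoch q hq (- z))).
  set (F := CSeries (fun n => qpoch (- z) q n * q ^ (n * (n + 1) / 2))) in *.
  set (L := CSeries (fun n => z ^ n * q ^ (n ^ 2) / qpoch (- q) q n)).
  (* For each n the inner series is known in closed form, so the iterated series is a difference of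
     two convergent series and needs no further interchange. Solving its sum for [L] gives the
     second identity. *)
  assert (HB : is_series (fun n => q ^ (n * (n + 1) / 2)
      * CSeries (outer_term q z n))
    (euler_sum q (/ z * q) * F - euler_sum q q * L)).
  { apply (is_series_scal (V := C_NormedModule) (euler_sum q (/ z * q))) in HF.
    assert (H := is_series_minus (V := C_NormedModule) _ _ _ _ HF (HA z)).
    refine (is_series_ext _ _ _ _ H); intros n.
    rewrite (CSeries_unique _ _ (is_series_outer q hq z n Hz)).
    change (euler_sum q (/ z * q) * (qpoch (- z) q n * q ^ (n * (n + 1) / 2))
      - q ^ (n * (n + 1) / 2) * inner_sum q z n
      = q ^ (n * (n + 1) / 2)
        * (qpoch (- z) q n * euler_sum q (/ z * q) - inner_sum q z n)).
    ring. }
  split; [|split; [|split; [|split]]].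
  + eexists; exact HQ.
  + apply ex_series_qpoch, hq.
  + intros n; eexists; exact (is_series_outer q hq z n Hz).
  + eexists; exact HB.
  + rewrite HP, (qpoch_inf_unique _ _ _ HQ).
    unfold outer_term in HB; rewrite (CSeries_unique _ _ HB).
    field; exact HP0.
Qed.
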